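(* Fix testing parameters $\varepsilon,\alpha\in[0,1/2)$ and privacy parameter $\xi>0$. Let $\hat p$ and $q$ be known distributions over $[n]$, and let $p$ be an unknown distribution over $[n]$. Let $\eta:=d_{\rm TV}(q,\hat p)$. Then, if $\eta<\alpha$, any private augmented identity tester with privacy parameter $\xi$, accuracy parameter $\alpha$, distance parameter $\varepsilon$ and error probability $\delta=0.2$, for testing identity of $p$ and $q$ with prediction $\hat p$, requires $s$ samples, where $$ s\ \ge\ \Omega\left(\frac{\sqrt n}{\varepsilon^2}+\frac{n^{1/3}}{\varepsilon^{4/3}\xi^{2/3}}+\frac{\sqrt n}{\varepsilon\sqrt{\xi}}+\frac{1}{\varepsilon\xi}\right). $$
   Context: $[n]=\{1,\dots,n\}$. For distributions $p,q$ on $[n]$, $d_{\rm TV}(p,q)=\max_{S\subseteq[n]}|p(S)-q(S)|=\frac12\|p-q\|_1$. Differential privacy: for datasets $X,X'$, $\operatorname{Ham}(X,X')$ is the number of samples in which they differ. A randomized algorithm $\mathcal A$ is $\xi$-differentially private if for all $X,X'$ with $\operatorname{Ham}(X,X')=1$ and all sets $O$ of outputs, $\Pr[\mathcal A(X)\in O]\le e^{\xi}\Pr[\mathcal A(X')\in O]$. Private augmented identity tester: let $q$ (reference) and $\hat p$ (prediction) be known distributions over $[n]$. A randomized algorithm $\mathcal A$ receiving $s$ i.i.d. samples from an unknown distribution $p$ over $[n]$ and returning a value in $\{\mathsf{accept},\mathsf{reject},\bot\}$ is a private augmented identity tester with privacy parameter $\xi$, distance parameter $\varepsilon$, accuracy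 parameter $\alpha$ and error probability $\delta$ if: (1) $\mathcal A$ is $\xi$-differentially private (with respect to the samples); (2) if $p=q$, $\mathcal A$ outputs $\mathsf{reject}$ with probability at most $\delta$; (3) if $d_{\rm TV}(p,q)>\varepsilon$, $\mathcal A$ outputs $\mathsf{accept}$ with probability at most $\delta$; (4) if $d_{\rm TV}(p,\hat p)\le\alpha$, $\mathcal A$ outputs $\bot$ with probability at most $\delta$.
   Formalization: The bound is proved for n ≥ 2 and, for each n, for some hard reference q (one q serving all p̂, ε, α, ξ), not for every q: for q a point mass, O(1/ε + 1/(εξ)) samples suffice, and for n = 1 no samples are needed. *)

(* Defs.v *)
From HB Require Import structures.
From mathcomp Require Import all_boot all_order all_algebra.
From mathcomp Require Import reals constructive_ereal sequences exp.

Set Implicit Arguments.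
Unset Strict Implicit.
Unset Printing Implicit Defensive.

Import Order.TTheory GRing.Theory Num.Theory.
Local Open Scope ring_scope.

Record fdist (R : numDomainType) (T : finType) := FDist {
  fdist_fun :> {ffun T -> R};
  fdist_ge0 : forall x, 0 <= fdist_fun x;
  fdist_sum1 : \sum_x fdist_fun x = 1 }.

Definition Pr (R : numDomainType) (T : finType) (p : fdist R T) (S : {set T}) : R :=
  \sum_(x in S) p x.

Definition dTV (R : realDomainType) (T : finType) (p q : fdist R T) : R :=
  \big[Num.max/0]_(S : {set T}) `|Pr p S - Pr q S|.

Lemma dTV_half_l1 (R : realFieldType) (T : finType) (p q : fdist R T) :
  dTV p q = 2^-1 * \sum_x `|p x - q x|.
Proof.
pose f x := p x - q x.
have f0 : \sum_x f x = 0 by rewrite sumrB !fdist_sum1 subrr.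
have PrB (S : {set T}) : Pr p S - Pr q S = \sum_(x in S) f x by rewrite /Pr -sumrB.
pose S0 : {set T} := [set x | 0 <= f x].
have split (S : {set T}) : \sum_(x in S) f x = - \sum_(x in ~: S) f x.
  apply/eqP; rewrite -addr_eq0; apply/eqP; rewrite -[RHS]f0 [RHS](bigID (mem S)) /=.
  by congr (_ + _); apply: eq_bigl => x; rewrite inE.
have half (S : {set T}) : `|\sum_(x in S) f x| <= 2^-1 * \sum_x `|f x|.
  rewrite mulrC ler_pdivlMr ?ltr0n// mulr_natr mulr2n {2}split normrN.
  rewrite [leRHS](bigID (mem S)) /= lerD //; first exact: ler_norm_sum.
  apply: le_trans (ler_norm_sum _ _ _) _.
  by rewrite le_eqVlt; apply/orP; left; apply/eqP; apply: eq_bigl => x; rewrite inE.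
apply/eqP; rewrite eq_le; apply/andP; split.
  rewrite /dTV; apply: (big_ind (fun z => z <= _)) => [|x y hx hy|S _]; last by rewrite PrB half.
    by rewrite mulr_ge0 ?invr_ge0 ?ler0n// sumr_ge0.
  by rewrite ge_max hx hy.
rewrite /dTV (bigD1 S0) //= le_max; apply/orP; left; rewrite PrB.
rewrite mulrC ler_pdivrMr ?ltr0n// mulr_natr mulr2n {2}split normrN.
rewrite (bigID (mem S0)) /= lerD //.
  rewrite ger0_norm ?sumr_ge0//; last by move=> x; rewrite inE.
  by apply: ler_sum => x; rewrite inE => /ger0_norm ->.
rewrite -normrN -sumrN ger0_norm; last first.
  by apply: sumr_ge0 => x; rewrite !inE -ltNge oppr_ge0 => /ltW.
rewrite [leRHS](eq_bigl (fun x => x \notin S0)); last by move=> x; rewrite inE.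
by apply: ler_sum => x; rewrite inE -ltNge => /ltr0_norm ->.
Qed.

Inductive verdict := Accept | Reject | Abstain.

Definition verdict_to_ord (v : verdict) : 'I_3 :=
  match v with Accept => inord 0 | Reject => inord 1 | Abstain => inord 2 end.

Definition verdict_of_ord (i : 'I_3) : verdict :=
  match val i with 0 => Accept | 1 => Reject | _ => Abstain end.

Lemma verdict_to_ordK : cancel verdict_to_ord verdict_of_ord.
Proof. by case; rewrite /verdict_of_ord /= inordK. Qed.

HB.instance Definition _ := Finite.copy verdict (can_type verdict_to_ordK).

Definition dataset (n s : nat) := {ffun 'I_s -> 'I_n}.

Definition Ham (n s : nat) (X X' : dataset n s) : nat := #|[set i | X i != X' i]|.

(* A randomized algorithm gives, for each dataset, the law of its output. *)
Definition algorithm (R : numDomainType) (n s : nat) :=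
  dataset n s -> fdist R verdict.

Definition differentially_private (R : realType) (n s : nat) (xi : R)
    (A : algorithm R n s) : Prop :=
  forall X X' : dataset n s, Ham X X' = 1%N ->
  forall O : {set verdict}, Pr (A X) O <= expR xi * Pr (A X') O.

(* Probability of output [v] over both the [s] i.i.d. samples from [p] and the
   internal randomness of [A]. *)
Definition output_prob (R : realType) (n s : nat) (A : algorithm R n s)
    (p : fdist R 'I_n) (v : verdict) : R :=
  \sum_(X : dataset n s) (\prod_(i < s) p (X i)) * A X v.

(* [Abstain] is the output written "bottom". *)
Definition private_augmented_tester (R : realType) (n s : nat)
    (q phat : fdist R 'I_n) (xi eps alpha delta : R) (A : algorithm R n s) : Prop :=
  [/\ differentially_private xi A,
      output_prob A q Reject <= delta,
      forall p, eps < dTV p q -> output_prob A p Accept <= delta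
    & forall p, dTV p phat <= alpha -> output_prob A p Abstain <= delta].

(* Extended-real valued because [eps = 0] is allowed: there [0^-1 = +oo] in
   [\bar R], whereas [0^-1 = 0] in [R]. *)
Definition sample_bound (R : realType) (n : nat) (eps xi : R) : \bar R :=
  ((Num.sqrt n%:R)%:E / (eps ^+ 2)%:E
   + (n%:R `^ 3^-1)%:E / (eps `^ (4 / 3) * xi `^ (2 / 3))%:E
   + (Num.sqrt n%:R)%:E / (eps * Num.sqrt xi)%:E
   + 1 / (eps * xi)%:E)%E.

Lemma sample_bound_eps0 (R : realType) (n : nat) (xi : R) :
  (0 < n)%N -> 0 < xi -> sample_bound n 0 xi = +oo%E.
Proof.
move=> n0 xi0; have s0 : 0 < Num.sqrt n%:R :> R by rewrite sqrtr_gt0 ltr0n.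
have r0 : 0 < n%:R `^ 3^-1 :> R by apply: powR_gt0; rewrite ltr0n.
have e43 : 4 / 3 != 0 :> R by rewrite mulf_neq0 ?invr_eq0 ?pnatr_eq0.
rewrite /sample_bound expr0n /= powR0// !mul0r inve0.
by rewrite !gt0_muley ?lte_fin.
Qed.

Lemma sample_bound_gt0 (R : realType) (n : nat) (eps xi : R) :
  0 < eps -> 0 < xi ->
  sample_bound n eps xi =
    (Num.sqrt n%:R / eps ^+ 2 + n%:R `^ 3^-1 / (eps `^ (4 / 3) * xi `^ (2 / 3))
     + Num.sqrt n%:R / (eps * Num.sqrt xi) + 1 / (eps * xi))%:E.
Proof.
move=> e0 x0; rewrite /sample_bound !inver.
by rewrite !gt_eqF ?mulr_gt0 ?powR_gt0 ?sqrtr_gt0 ?exprn_gt0.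
Qed.

(* Main.v *)
Require Import Defs.
From mathcomp Require Import all_boot all_order all_algebra.
From mathcomp Require Import reals constructive_ereal sequences exp.
From mathcomp Require Import ring lra.
Import Order.TTheory GRing.Theory Num.Theory.
Local Open Scope ring_scope.

(* Take q uniform on 2m points, m = n/2, grouped in m pairs, and let p_z tilt
   the j-th pair by t z_j, where z is a uniformly random sign vector and
   2 eps < t <= 4 eps; then dTV p_z q = t/2 > eps. The prediction is compatible with
   p = q, so f = Pr[accept] has mean at least 3/5 under q, but at most 1/5 under
   every p_z. The chi-square distance between the mixture of the p_z^s and q^s
   gives the bound sqrt n / eps^2.

   For the private terms, condition on the pairs J of the samples and tilt the
   fair bits one sample at a time. Since f is 2xi-Lipschitz for the Hamming
   distance, the l-th step costs at most t xi. Averaging over the sign of the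
   pair J_l, that step also carries the L1 distance between tilting and not
   tilting the r_l earlier samples of the same pair, hence costs
   O(t^2 xi sqrt r_l). As E r_l <= s/m, summing over l with sqrt r <= r, and with
   E sqrt r_l <= sqrt (s/m), yields the remaining three terms. *)

Set Implicit Arguments.
Unset Strict Implicit.
Unset Printing Implicit Defensive.

(** * Uniform averages over finite types *)

Section Mean.
Variable R : realType.

Definition mean (T : finType) (f : T -> R) : R := #|T|%:R^-1 * \sum_x f x.

Variable T : finType.
Implicit Types f g w : T -> R.

Lemma eq_mean f g : f =1 g -> mean f = mean g.
Proof. by move=> fg; rewrite /mean (eq_bigr g). Qed.

Lemma meanD f g : mean (fun x => f x + g x) = mean f + mean g.
Proof. by rewrite /mean big_split mulrDr. Qed.

Lemma meanZ c f : mean (fun x => c * f x) = c * mean f.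
Proof. by rewrite /mean -mulr_sumr mulrCA. Qed.

Lemma meanZr c f : mean (fun x => f x * c) = mean f * c.
Proof. by rewrite /mean -mulr_suml mulrA. Qed.

Lemma meanN f : mean (fun x => - f x) = - mean f.
Proof. by rewrite /mean sumrN mulrN. Qed.

Lemma meanB f g : mean (fun x => f x - g x) = mean f - mean g.
Proof. by rewrite meanD meanN. Qed.

Lemma mean_sum (I : Type) (r : seq I) (P : pred I) (F : I -> T -> R) :
  mean (fun x => \sum_(i <- r | P i) F i x) = \sum_(i <- r | P i) mean (F i).
Proof. by rewrite /mean exchange_big mulr_sumr. Qed.

Lemma ler_mean f g : (forall x, f x <= g x) -> mean f <= mean g.
Proof. by move=> fg; rewrite /mean ler_wpM2l ?invr_ge0// ler_sum. Qed.

Lemma mean_ge0 f : (forall x, 0 <= f x) -> 0 <= mean f.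
Proof. by move=> f0; rewrite /mean mulr_ge0 ?invr_ge0// sumr_ge0. Qed.

Lemma ler_norm_mean f : `|mean f| <= mean (fun x => `|f x|).
Proof.
by rewrite /mean normrM ger0_norm ?invr_ge0// ler_wpM2l ?invr_ge0// ler_norm_sum.
Qed.

(** On an empty type every mean is 0, since [0^-1 = 0]. *)
Lemma mean_cst c : (0 < #|T|)%N -> mean (fun _ : T => c) = c.
Proof.
move=> T0; rewrite /mean sumr_const -[c *+ _]mulr_natl mulKf//.
by rewrite pnatr_eq0 -lt0n.
Qed.

Lemma mean_involutive (h : T -> T) f : involutive h -> mean (fun x => f (h x)) = mean f.
Proof.
move=> hK; rewrite /mean [in RHS](reindex_inj (inv_inj hK)); congr (_ * _).
Qed.

(** The variance of [f] under the density [w] is nonnegative. *)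
Lemma sqr_mean_le w f : (forall x, 0 <= w x) -> mean w = 1 ->
  mean (fun x => w x * f x) ^+ 2 <= mean (fun x => w x * f x ^+ 2).
Proof.
move=> w0 w1; set c := mean _.
have : 0 <= mean (fun x => w x * (f x - c) ^+ 2).
  by apply: mean_ge0 => x; rewrite mulr_ge0 ?sqr_ge0.
rewrite (@eq_mean _ (fun x => w x * f x ^+ 2 + (c ^+ 2 * w x - 2 * c * (w x * f x)))).
  by rewrite meanD meanB !meanZ w1 -/c; nra.
by move=> x; ring.
Qed.

End Mean.

(** * Iterated averages and averages over function spaces *)

Section MeanProduct.
Variable R : realType.

Lemma exchange_mean (T U : finType) (f : T -> U -> R) :
  mean (fun x => mean (f x)) = mean (fun y => mean (f^~ y)).
Proof.
rewrite /mean -!mulr_sumr exchange_big /= mulrCA; congr (_ * _).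
Qed.

(** Independence of the coordinates of a uniformly random function, by distributivity. *)
Lemma mean_prod (I T : finType) (g : I -> T -> R) :
  mean (fun b : {ffun I -> T} => \prod_i g i (b i)) = \prod_i mean (g i).
Proof.
rewrite /mean big_split /= prodr_const -bigA_distr_bigA card_ffun natrX exprVn.
by [].
Qed.

Lemma mean_bool (g : bool -> R) : mean g = (g true + g false) / 2.
Proof. by rewrite /mean card_bool big_bool mulrC. Qed.

Lemma card_ffun_gt0 (I T : finType) : (0 < #|T|)%N -> (0 < #|{ffun I -> T}|)%N.
Proof. by move=> T0; rewrite card_ffun expn_gt0 T0. Qed.

End MeanProduct.

(** * Product laws of biased bits *)

Section Tilt.
Variable R : realType.

Definition sgn (b : bool) : R := (-1) ^+ b.

Lemma normr_sgn b : `|sgn b| = 1.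
Proof. by rewrite /sgn normrX normrN1 expr1n. Qed.

Lemma sgn_mul b : sgn b * sgn b = 1.
Proof. by rewrite /sgn -expr2 sqrr_sign. Qed.

Lemma sgn_addb1 b : sgn (b (+) true) = - sgn b.
Proof. by case: b; rewrite /sgn ?opprK ?expr0 ?expr1 //= opprK. Qed.

Variable I : finType.

(** Density, relative to fair bits, of independent bits whose [i]-th sign has mean [a i], provided
    that [|a i| <= 1]. *)
Definition tilt (a : I -> R) (b : {ffun I -> bool}) : R :=
  \prod_i (1 + a i * sgn (b i)).

Definition flip (k : I) (b : {ffun I -> bool}) : {ffun I -> bool} :=
  [ffun i => b i (+) (i == k)].

Lemma flipK k : involutive (flip k).
Proof. by move=> b; apply/ffunP => i; rewrite !ffunE addbK. Qed.

Lemma sgn_flip k b : sgn (flip k b k) = - sgn (b k).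
Proof. by rewrite ffunE eqxx sgn_addb1. Qed.

Lemma tilt_ge0 a b : (forall i, `|a i| <= 1) -> 0 <= tilt a b.
Proof.
move=> a1; apply: prodr_ge0 => i _.
have : `|a i * sgn (b i)| <= 1 by rewrite normrM normr_sgn mulr1.
by rewrite ler_norml; lra.
Qed.

Lemma mean_tilt a : mean (tilt a) = 1.
Proof.
rewrite /tilt (mean_prod (fun i x => 1 + a i * sgn x)) big1// => i _.
by rewrite mean_bool /sgn; field.
Qed.

Lemma mean_tilt_mul a c :
  mean (fun b => tilt a b * tilt c b) = \prod_i (1 + a i * c i).
Proof.
rewrite (@eq_mean _ _ _ (fun b : {ffun I -> bool} =>
  \prod_i ((1 + a i * sgn (b i)) * (1 + c i * sgn (b i))))); last first.
  by move=> b; rewrite big_split.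
rewrite (mean_prod (fun i x => (1 + a i * sgn x) * (1 + c i * sgn x))).
by apply: eq_bigr => i _; rewrite mean_bool /sgn; field.
Qed.

(** Chi-square distance between the tilts by [a0 + a1] and by [a0]: with disjoint supports the
    former is [tilt a0 * tilt a1], and each factor of the second moment has mean [1 + a1 i ^+ 2]. *)
Lemma mean_tilt_sqr (a0 a1 : I -> R) : (forall i, a0 i * a1 i = 0) ->
  mean (fun b => tilt a0 b * (tilt a1 b - 1) ^+ 2) = \prod_i (1 + a1 i ^+ 2) - 1.
Proof.
move=> a01.
rewrite (@eq_mean _ _ _ (fun b => tilt a0 b * tilt a1 b ^+ 2 +
  (tilt a0 b - 2 * (tilt a0 b * tilt a1 b)))); last by move=> b; ring.
rewrite meanD meanB meanZ mean_tilt mean_tilt_mul [X in 2 * X]big1; last first.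
  by move=> i _; rewrite a01 addr0.
rewrite (@eq_mean _ _ _ (fun b : {ffun I -> bool} =>
  \prod_i ((1 + a0 i * sgn (b i)) * (1 + a1 i * sgn (b i)) ^+ 2))); last first.
  by move=> b; rewrite big_split prodrXl.
rewrite (mean_prod (fun i x => (1 + a0 i * sgn x) * (1 + a1 i * sgn x) ^+ 2)).
rewrite (eq_bigr (fun i => 1 + a1 i ^+ 2)); first by lra.
move=> i _; rewrite mean_bool /sgn.
transitivity (1 + a1 i ^+ 2 + 2 * (a0 i * a1 i)); first by field.
by rewrite a01 mulr0 addr0.
Qed.

Lemma tiltD (a0 a1 : I -> R) b : (forall i, a0 i * a1 i = 0) ->
  tilt (fun i => a0 i + a1 i) b = tilt a0 b * tilt a1 b.
Proof.
move=> a01; rewrite /tilt -big_split; apply: eq_bigr => i _ /=.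
transitivity ((1 + a0 i * sgn (b i)) * (1 + a1 i * sgn (b i))
  - (a0 i * a1 i) * (sgn (b i)) ^+ 2); first by ring.
by rewrite a01 mul0r subr0.
Qed.

(** Weierstrass product inequality; the upper bound 1 feeds the induction. *)
Lemma prod1B_ge (J : Type) (r : seq J) (x : J -> R) : (forall i, 0 <= x i <= 1) ->
  1 - \sum_(i <- r) x i <= \prod_(i <- r) (1 - x i) <= 1.
Proof.
move=> x01; elim: r => [|i r IH]; first by rewrite !big_nil; lra.
rewrite !big_cons; have := x01 i.
have : 0 <= \prod_(j <- r) (1 - x j).
  by apply: prodr_ge0 => j _; have := x01 j; lra.
have : 0 <= \sum_(j <- r) x j by apply: sumr_ge0 => j _; have := x01 j; lra.
by nra.
Qed.

(** Since [(1 + x)(1 - x) <= 1], the product is at most [1 / (1 - S)] with [S] the sum, hence at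
    most [1 + 2 S] for [S <= 1/2]. *)
Lemma prod1D_le (x : I -> R) : (forall i, 0 <= x i) -> \sum_i x i <= 1 / 2 ->
  \prod_i (1 + x i) <= 1 + 2 * \sum_i x i.
Proof.
move=> x0 xs.
have x1 i : 0 <= x i <= 1.
  rewrite x0 /=; move: xs; rewrite (bigD1 i)//=.
  have : 0 <= \sum_(j | j != i) x j by apply: sumr_ge0.
  by lra.
have /andP[p1 _] := prod1B_ge (index_enum I) x1.
have : \prod_i (1 + x i) * \prod_i (1 - x i) <= 1.
  rewrite -big_split /=; apply: prodr_ile1 => i _.
  by have := x1 i; nra.
have : 0 <= \prod_i (1 + x i) by apply: prodr_ge0 => i _; have := x0 i; lra.
have : 0 <= \sum_i x i by apply: sumr_ge0.
move: xs p1; set S := \sum_i x i; set P := \prod_i _; set Q := \prod_i _.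
by move=> *; nra.
Qed.

(** For [v <= 1/2], Cauchy-Schwarz bounds the squared L1 distance by the chi-square distance, at
    most [2 v]. For larger [v], two densities are at L1 distance at most 2, and [4 <= 8 v]. *)
Lemma tilt_L1 (a0 a1 : I -> R) :
  (forall i, a0 i * a1 i = 0) -> (forall i, `|a0 i| <= 1) -> (forall i, `|a1 i| <= 1) ->
  mean (fun b => `|tilt (fun i => a0 i + a1 i) b - tilt a0 b|) ^+ 2
    <= 8 * \sum_i a1 i ^+ 2.
Proof.
move=> a01 h0 h1; set v := \sum_i _.
have v0 : 0 <= v by apply: sumr_ge0 => i _; rewrite sqr_ge0.
have t0 b : 0 <= tilt a0 b by apply: tilt_ge0.
have [vs|vl] := lerP v (1 / 2).
  rewrite (@eq_mean _ _ _ (fun b => tilt a0 b * `|tilt a1 b - 1|)); last first.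
    by move=> b; rewrite tiltD// -{2}[tilt a0 b]mulr1 -mulrBr normrM ger0_norm.
  apply: le_trans (sqr_mean_le _ t0 (mean_tilt _)) _.
  under eq_mean do rewrite real_normK ?num_real//.
  rewrite mean_tilt_sqr//.
  have := @prod1D_le (fun i => a1 i ^+ 2) (fun i => sqr_ge0 _) vs.
  by rewrite -/v; lra.
have M0 : 0 <= mean (fun b => `|tilt (fun i => a0 i + a1 i) b - tilt a0 b|).
  by apply: mean_ge0.
suff : mean (fun b => `|tilt (fun i => a0 i + a1 i) b - tilt a0 b|) <= 2 by nra.
have -> : 2 = mean (fun b => tilt (fun i => a0 i + a1 i) b + tilt a0 b).
  by rewrite meanD !mean_tilt; ring.
apply: ler_mean => b; apply: le_trans (ler_normB _ _) _.
rewrite !ger0_norm// tiltD// mulr_ge0// tilt_ge0//.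
Qed.

End Tilt.

(** * Tilting the samples one at a time *)

Section Hybrid.
Variable R : realType.

Lemma tilt_flip (I : finType) (a : I -> R) k b : a k = 0 -> tilt a (flip k b) = tilt a b.
Proof.
move=> ak; apply: eq_bigr => i _; rewrite ffunE.
by have [->|ik] := eqVneq i k; rewrite ?ak ?mul0r ?addbF.
Qed.

(** The tilt is affine in its [k]-th entry and [tilt a] ignores the bit [k], so only the part of [g]
    that is odd in this bit contributes. *)
Lemma mean_tilt_bump (I : finType) (a : I -> R) (c : R) k (g : {ffun I -> bool} -> R) :
  a k = 0 ->
  mean (fun b => tilt (fun i => a i + c * (i == k)%:R) b * g b) - mean (fun b => tilt a b * g b)
  = mean (fun b => c * (tilt a b * (sgn R (b k) * (g b - g (flip k b))))) / 2.
Proof.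
move=> ak; rewrite -meanB.
have odd : mean (fun b => tilt a b * (sgn R (b k) * g (flip k b)))
    = - mean (fun b => tilt a b * (sgn R (b k) * g b)).
  rewrite -meanN -(mean_involutive _ (@flipK _ k)); apply: eq_mean => b.
  by rewrite flipK sgn_flip tilt_flip//; ring.
rewrite meanZ [X in c * X](@eq_mean _ _ _ (fun b =>
  tilt a b * (sgn R (b k) * g b) - tilt a b * (sgn R (b k) * g (flip k b)))); last first.
  by move=> b; ring.
rewrite [in RHS]meanB odd.
rewrite (@eq_mean _ _ _ (fun b => c * (tilt a b * (sgn R (b k) * g b)))); last first.
  move=> b; rewrite tiltD => [|i]; last first.
    by have [->|ik] := eqVneq i k; rewrite ?ak ?mul0r ?mulr0.
  rewrite [tilt (fun i => c * _) b](_ : _ = 1 + c * sgn R (b k)); first by ring.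
  rewrite /tilt (bigD1 k)//= eqxx mulr1 big1 ?mulr1// => i /negPf ->.
  by rewrite mulr0 mul0r addr0.
by rewrite meanZ; field.
Qed.

Variables (m s : nat) (J : {ffun 'I_s -> 'I_m}) (t L : R) (g : {ffun 'I_s -> bool} -> R).
Hypothesis t01 : 0 <= t <= 1.
Hypothesis gL : forall k b, `|g b - g (flip k b)| <= L.

(** Interpolates from fair bits at [l = 0] to fully perturbed samples at [l = s]. *)
Definition hybrid (z : {ffun 'I_m -> bool}) (l : nat) (i : 'I_s) : R :=
  if (i < l)%N then t * sgn R (z (J i)) else 0.

Definition hybrid_mean l z : R := mean (fun b => tilt (hybrid z l) b * g b).

Definition earlier (l : 'I_s) : R := \sum_(i < s) ((i < l)%N && (J i == J l))%:R.

Lemma earlier_ge0 l : 0 <= earlier l.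
Proof. by apply: sumr_ge0. Qed.

Lemma normr_tsgn b : `|t * sgn R b| = t.
Proof. by rewrite normrM normr_sgn mulr1 ger0_norm//; case/andP: t01. Qed.

Lemma hybrid_le1 z l i : `|hybrid z l i| <= 1.
Proof.
by rewrite /hybrid; case: ifP; rewrite ?normr_tsgn ?normr0//; case/andP: t01.
Qed.

(* Any [c] not depending on the sign [z (J l)] satisfies the hypothesis, so it
   can be subtracted from the tilt for free. *)
Lemma hybrid_step (l : 'I_s) (c : {ffun 'I_m -> bool} -> {ffun 'I_s -> bool} -> R) :
  (forall b, mean (fun z : {ffun 'I_m -> bool} => sgn R (z (J l)) * c z b) = 0) ->
  `|mean (fun z : {ffun 'I_m -> bool} => hybrid_mean l.+1 z - hybrid_mean l z)|
    <= t * L / 2 * mean (fun z : {ffun 'I_m -> bool} => mean (fun b => `|tilt (hybrid z l) b - c z b|)).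
Proof.
move=> c0; have [t0 _] := andP t01.
have -> : mean (fun z : {ffun 'I_m -> bool} => hybrid_mean l.+1 z - hybrid_mean l z)
   = mean (fun b : {ffun 'I_s -> bool} => t / 2 * (sgn R (b l) * (g b - g (flip l b)))
       * mean (fun z : {ffun 'I_m -> bool} => sgn R (z (J l)) * (tilt (hybrid z l) b - c z b))).
  transitivity (mean (fun z : {ffun 'I_m -> bool} => mean (fun b : {ffun 'I_s -> bool} =>
       t / 2 * (sgn R (b l) * (g b - g (flip l b)))
       * (sgn R (z (J l)) * tilt (hybrid z l) b)))).
    apply: eq_mean => z; rewrite /hybrid_mean.
    have -> : mean (fun b => tilt (hybrid z l.+1) b * g b) =
      mean (fun b => tilt (fun i => hybrid z l i + (t * sgn R (z (J l))) * (i == l)%:R) b * g b).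
      apply: eq_mean => b; congr (_ * _); apply: eq_bigr => i _; congr (1 + _ * _).
      rewrite /hybrid ltnS leq_eqVlt.
      have [->|il] := eqVneq i l; first by rewrite eqxx ltnn /= mulr1 add0r.
      by rewrite -val_eqE in il; rewrite (negPf il) mulr0 addr0.
    rewrite mean_tilt_bump; last by rewrite /hybrid ltnn.
    by rewrite -meanZr; apply: eq_mean => b; ring.
  (* With [z] averaged inside, [c] can be subtracted: by [c0] its average against the sign of the
     pair [J l] is 0. *)
  rewrite exchange_mean; apply: eq_mean => b; rewrite meanZ; congr (_ * _).
  rewrite -[LHS]subr0 -(c0 b) -meanB; apply: eq_mean => z; ring.
rewrite [in leRHS]exchange_mean -meanZ.
apply: le_trans (ler_norm_mean _) _; apply: ler_mean => b.
rewrite normrM; apply: ler_pM => //.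
  rewrite normrM [`|sgn _ _ * _|]normrM normr_sgn mul1r ger0_norm ?divr_ge0//.
  by rewrite [leRHS]mulrAC ler_wpM2l ?divr_ge0//.
apply: le_trans (ler_norm_mean _) _; apply: ler_mean => z.
by rewrite normrM normr_sgn mul1r.
Qed.

Lemma ffun_bool_gt0 : (0 < #|{ffun 'I_m -> bool}|)%N.
Proof. by rewrite card_ffun_gt0// card_bool. Qed.

Lemma lipschitz_cst_ge0 (l : 'I_s) : 0 <= L.
Proof. by apply: le_trans (gL l [ffun => true]); rewrite normr_ge0. Qed.

(** Here [c = 0], and the tilt is a density, of L1 norm 1. *)
Lemma hybrid_step_linear (l : 'I_s) :
  `|mean (fun z : {ffun 'I_m -> bool} => hybrid_mean l.+1 z - hybrid_mean l z)| <= t * L / 2.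
Proof.
apply: le_trans (hybrid_step (c := fun _ _ => 0) _) _.
  by move=> b; under eq_mean do rewrite mulr0; rewrite mean_cst ?ffun_bool_gt0.
have -> : mean (fun z : {ffun 'I_m -> bool} => mean (fun b => `|tilt (hybrid z l) b - 0|)) = 1.
  rewrite -[RHS](mean_cst 1 ffun_bool_gt0); apply: eq_mean => z.
  rewrite -[RHS](mean_tilt (hybrid z l)); apply: eq_mean => b.
  by rewrite subr0 ger0_norm// tilt_ge0// => i; exact: hybrid_le1.
by rewrite mulr1.
Qed.

(** Here [c] leaves out the tilts of all samples in the pair [J l], so it ignores [z (J l)]. The
    omitted entries have squared norm [t ^+ 2 * earlier l], which [tilt_L1] turns into an L1
    distance. *)
Lemma hybrid_step_sqrt (l : 'I_s) :
  `|mean (fun z : {ffun 'I_m -> bool} => hybrid_mean l.+1 z - hybrid_mean l z)|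
    <= 3 / 2 * t ^+ 2 * L * Num.sqrt (earlier l).
Proof.
have [t0 t1] := andP t01.
pose a0 (z : {ffun 'I_m -> bool}) (i : 'I_s) : R := if J i == J l then 0 else hybrid z l i.
pose a1 (z : {ffun 'I_m -> bool}) (i : 'I_s) : R := if J i == J l then hybrid z l i else 0.
apply: le_trans (hybrid_step (c := fun z => tilt (a0 z)) _) _.
  (* Flipping the sign of the pair [J l] fixes [tilt (a0 z)] and negates the other factor. *)
  move=> b; set M := mean _; suff : M = - M by lra.
  rewrite {1}/M -(mean_involutive _ (@flipK _ (J l))) /M -meanN.
  apply: eq_mean => z; rewrite sgn_flip mulNr; congr (- (_ * _)).
  apply: eq_bigr => i _; rewrite /a0 /hybrid ffunE.
  by have [//|] := eqVneq (J i) (J l); rewrite addbF.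
(* The factor 3 is an upper bound for the square root of the 8 in [tilt_L1]. *)
have -> : 3 / 2 * t ^+ 2 * L * Num.sqrt (earlier l)
  = t * L / 2 * (3 * t * Num.sqrt (earlier l)) by field.
rewrite ler_wpM2l//; first by rewrite divr_ge0// mulr_ge0//; exact: lipschitz_cst_ge0.
rewrite -[leRHS](mean_cst _ ffun_bool_gt0); apply: ler_mean => z /=.
have r0 := earlier_ge0 l.
rewrite -(@ler_pXn2r _ 2) ?nnegrE //; last 2 first.
- by apply: mean_ge0.
- by rewrite !mulr_ge0 ?sqrtr_ge0.
rewrite [leRHS]exprMn [in leRHS]exprMn sqr_sqrtr//.
have -> : mean (fun b => `|tilt (hybrid z l) b - tilt (a0 z) b|) =
   mean (fun b => `|tilt (fun i => a0 z i + a1 z i) b - tilt (a0 z) b|).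
  apply: eq_mean => b; congr `|_ - _|; apply: eq_bigr => i _; congr (1 + _ * _).
  by rewrite /a0 /a1; case: ifP; rewrite ?add0r ?addr0.
apply: le_trans (tilt_L1 _ _ _) _.
- by move=> i; rewrite /a0 /a1; case: ifP; rewrite ?mul0r ?mulr0.
- by move=> i; rewrite /a0; case: ifP; rewrite ?normr0// hybrid_le1.
- by move=> i; rewrite /a1; case: ifP; rewrite ?normr0// hybrid_le1.
have -> : \sum_i a1 z i ^+ 2 = t ^+ 2 * earlier l.
  rewrite mulr_sumr; apply: eq_bigr => i _; rewrite /a1 /hybrid.
  case: ifP => _; last by rewrite andbF mulr0 expr0n.
  rewrite andbT; case: ifP => _; last by rewrite mulr0 expr0n.
  by rewrite exprMn [sgn _ _ ^+ 2]expr2 sgn_mul.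
have : 0 <= t ^+ 2 * earlier l by rewrite mulr_ge0// sqr_ge0.
by rewrite -mulrA; lra.
Qed.

Lemma hybrid_telescope (B : 'I_s -> R) :
  (forall l : 'I_s, `|mean (fun z : {ffun 'I_m -> bool} => hybrid_mean l.+1 z - hybrid_mean l z)| <= B l) ->
  `|mean (hybrid_mean s) - mean g| <= \sum_l B l.
Proof.
move=> hB.
have -> : mean g = mean (hybrid_mean 0).
  rewrite -[LHS](mean_cst _ ffun_bool_gt0); apply: eq_mean => z.
  apply: eq_mean => b; rewrite /tilt big1 ?mul1r// => i _.
  by rewrite /hybrid ltn0 mul0r addr0.
rewrite -(telescope_sumr (fun l => mean (hybrid_mean l)) (leq0n s)) big_mkord.
apply: le_trans (ler_norm_sum _ _ _) _; apply: ler_sum => l _.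
by rewrite -meanB.
Qed.

End Hybrid.

(** Two distinct samples fall in the same pair with probability [1/m], and at most [s] samples are
    earlier. *)
Lemma mean_earlier (R : realType) (m s : nat) (l : 'I_s) : (0 < m)%N ->
  mean (fun J : {ffun 'I_s -> 'I_m} => earlier R J l) <= s%:R / m%:R.
Proof.
move=> m0; rewrite mean_sum.
have -> : s%:R / m%:R = \sum_(i < s) (m%:R^-1 : R).
  by rewrite sumr_const card_ord mulr_natl.
apply: ler_sum => i _.
have [il|] := boolP (i < l)%N; last first.
  by move=> _; rewrite (@eq_mean _ _ _ (fun=> 0))// mean_cst ?invr_ge0// card_ffun_gt0// card_ord.
have nil : l != i by rewrite -val_eqE gtn_eqF.
(* Splitting the collision over the common pair [j] gives products over coordinates, to which
   [mean_prod] applies. *)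
rewrite (@eq_mean _ _ _ (fun J : {ffun 'I_s -> 'I_m} => \sum_(j < m)
  \prod_k (if k == i then (J k == j)%:R else if k == l then (J k == j)%:R else 1))).
  rewrite mean_sum (eq_bigr (fun=> m%:R^-1 ^+ 2)).
    rewrite sumr_const card_ord -[X in X <= _]mulr_natl expr2 mulVKf//.
    by rewrite pnatr_eq0 -lt0n.
  move=> j _; rewrite (mean_prod (fun k x =>
    if k == i then (x == j)%:R else if k == l then (x == j)%:R else 1)).
  have one : mean (fun x : 'I_m => (x == j)%:R : R) = m%:R^-1.
    rewrite /mean card_ord (bigD1 j)//= eqxx big1 ?addr0 ?mulr1// => x /negPf ->//.
  rewrite (bigD1 i)//= (bigD1 l)//= eqxx (negPf nil) eqxx one big1 ?mulr1 ?expr2//.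
  by move=> k /andP[/negPf -> /negPf ->]; rewrite mean_cst ?card_ord.
move=> J; rewrite /= (bigD1 (J l))//= [X in _ + X]big1 ?addr0.
  rewrite (bigD1 i)//= (bigD1 l)//= !eqxx (negPf nil) big1 ?mulr1//.
  by move=> k /andP[/negPf -> /negPf ->].
move=> j jl; rewrite (bigD1 i)//= (bigD1 l)//= eqxx (negPf nil) eqxx.
by rewrite [J l == j]eq_sym (negPf jl) mul0r mulr0.
Qed.

(** * Second moment of the likelihood ratio *)

Section ChiSquare.
Variables (R : realType) (m s : nat) (t : R).
Hypothesis m_gt0 : (0 < m)%N.
Hypothesis t01 : 0 <= t <= 1.

(** Likelihood ratio of the random perturbation against fair bits, given the pairs [J] of the
    samples. *)
Definition mixture (J : {ffun 'I_s -> 'I_m}) (b : {ffun 'I_s -> bool}) : R :=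
  mean (fun z : {ffun 'I_m -> bool} => tilt (fun i => t * sgn R (z (J i))) b).

Lemma sqr_mean_le1 (T : finType) (f : T -> R) : (0 < #|T|)%N ->
  mean f ^+ 2 <= mean (fun x => f x ^+ 2).
Proof.
move=> T0; have := @sqr_mean_le R T (fun=> 1) f (fun=> ler01) (mean_cst _ T0).
by rewrite (@eq_mean _ _ _ f) ?(@eq_mean _ _ (fun x => 1 * _) (fun x => f x ^+ 2))// => x;
  rewrite mul1r.
Qed.

Lemma exchange_mean3 (A B C : finType) (F : A -> B -> C -> R) :
  mean (fun a => mean (fun b => mean (F a b))) =
  mean (fun b => mean (fun c => mean (fun a => F a b c))).
Proof.
by rewrite exchange_mean; apply: eq_mean => b; rewrite exchange_mean.
Qed.

(** The mean is the hyperbolic cosine of [y] for either [c]; both exponentials are bounded by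
    [expR x <= (1 - x)^-1]. *)
Lemma mean_expR_le (y : R) (c : bool) : 0 <= y < 1 ->
  mean (fun b => expR (y * (sgn R b * sgn R c))) <= (1 - y ^+ 2)^-1.
Proof.
move=> /andP[y0 y1].
have -> : mean (fun b => expR (y * (sgn R b * sgn R c))) = (expR y + expR (- y)) / 2.
  rewrite mean_bool /sgn expr1 expr0 mulN1r mul1r mulrN.
  by case: c; rewrite ?expr1 ?expr0 ?mulrN1 ?mulr1 ?opprK// addrC.
have h (x : R) : -1 < x < 1 -> expR x <= (1 - x)^-1.
  move=> /andP[x1 x2]; have := expR_ge1Dx (- x).
  by rewrite expRN -[expR x <= _]lef_pV2 ?posrE ?invr_gt0 ?subr_gt0 ?expR_gt0// invrK.
have hy := h y; have hNy := h (- y).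
apply: (@le_trans _ _ (((1 - y)^-1 + (1 + y)^-1) / 2)).
  rewrite ler_wpM2r ?invr_ge0//; apply: lerD; first by apply: hy; lra.
  by rewrite -[X in (1 + X)]opprK; apply: hNy; lra.
have -> : ((1 - y)^-1 + (1 + y)^-1) / 2 = (1 - y ^+ 2)^-1; last by [].
by field; rewrite !gt_eqF//; nra.
Qed.

(** Ingster's method: squaring introduces an independent copy [z'] of [z]. Averaging over the
    samples leaves an [s]-th power, which [1 + x <= expR x] turns into a product over the pairs.
    Each pair costs [(1 - y^2)^-1] with [y = s t^2 / m], and [1 - m y^2 <= (1 - y^2)^m]. *)
Lemma mean_sqr_mixture : s%:R * t ^+ 2 / m%:R < 1 ->
  s%:R ^+ 2 * t ^+ 4 / m%:R < 1 ->
  mean (fun J => mean (fun b => mixture J b ^+ 2))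
    <= (1 - s%:R ^+ 2 * t ^+ 4 / m%:R)^-1.
Proof.
have mR : 0 < m%:R :> R by rewrite ltr0n.
have [t0 t1] := andP t01.
set y := s%:R * t ^+ 2 / m%:R => y1.
have y0 : 0 <= y by rewrite /y !mulr_ge0 ?invr_ge0 ?exprn_ge0.
have -> : s%:R ^+ 2 * t ^+ 4 / m%:R = m%:R * y ^+ 2.
  by rewrite /y; field; rewrite gt_eqF.
move=> my.
pose h (z z' : {ffun 'I_m -> bool}) (j : 'I_m) : R := t * sgn R (z j) * (t * sgn R (z' j)).
have -> : mean (fun J => mean (fun b => mixture J b ^+ 2)) =
    mean (fun z' => mean (fun z => mean (fun j => 1 + h z z' j) ^+ s)).
  transitivity (mean (fun J : {ffun 'I_s -> 'I_m} => mean (fun z' : {ffun 'I_m -> bool} =>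
      mean (fun z : {ffun 'I_m -> bool} => mean (fun b : {ffun 'I_s -> bool} =>
        tilt (fun i => t * sgn R (z (J i))) b * tilt (fun i => t * sgn R (z' (J i))) b))))).
    apply: eq_mean => J; rewrite -exchange_mean3; apply: eq_mean => b.
    by rewrite expr2 /mixture -meanZ; apply: eq_mean => z'; rewrite -meanZr.
  rewrite exchange_mean3; apply: eq_mean => z'; apply: eq_mean => z.
  rewrite -[s in RHS]card_ord -prodr_const.
  rewrite -(mean_prod (fun (_ : 'I_s) j => 1 + h z z' j)).
  by apply: eq_mean => J; rewrite mean_tilt_mul.
(* The estimate is uniform in [z']; only [z] is averaged. *)
rewrite -[leRHS](mean_cst _ (ffun_bool_gt0 m)); apply: ler_mean => z'.
apply: (@le_trans _ _ (mean (fun z : {ffun 'I_m -> bool} =>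
    \prod_j expR (y * (sgn R (z j) * sgn R (z' j)))))).
  apply: ler_mean => z; rewrite -expR_sum.
  (* Monotonicity of the [s]-th power is used on nonnegative bases. *)
  have h1 : 0 <= mean (fun j => 1 + h z z' j).
    apply: mean_ge0 => j; have : `|h z z' j| <= 1.
      by rewrite !normrM !normr_sgn !mulr1 ger0_norm// mulr_ile1.
    by rewrite ler_norml; lra.
  have -> : \sum_j y * (sgn R (z j) * sgn R (z' j)) = s%:R * mean (h z z').
    rewrite /mean card_ord -mulr_sumr /y /h.
    rewrite [in RHS](eq_bigr (fun j => t ^+ 2 * (sgn R (z j) * sgn R (z' j)))).
      by rewrite -mulr_sumr; ring.
    by move=> j _; ring.
  rewrite expRM_natl; apply: lerXn2r; rewrite ?nnegrE ?expR_ge0//.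
  by rewrite meanD mean_cst ?card_ord// expR_ge1Dx.
rewrite (mean_prod (fun j b => expR (y * (sgn R b * sgn R (z' j))))).
apply: (@le_trans _ _ (\prod_(j < m) (1 - y ^+ 2)^-1)).
  apply: ler_prod => j _; rewrite mean_expR_le ?y0 ?y1// andbT.
  by apply: mean_ge0 => b; rewrite expR_ge0.
have y2 : y ^+ 2 < 1 by nra.
rewrite prodfV lef_pV2 ?posrE ?subr_gt0//; last by apply: prodr_gt0 => j _; rewrite subr_gt0.
have := @prod1B_ge R _ (index_enum 'I_m) (fun=> y ^+ 2).
rewrite sumr_const card_ord -[_ *+ _]mulr_natl => /(_ _)/andP[]//.
by move=> _; rewrite sqr_ge0 ltW.
Qed.

(** The difference is the average of [(mixture - 1) * f]. Jensen over [J], then over [b], together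
    with [0 <= f <= 1], leaves the variance of the likelihood ratio, whose mean is 1 for each
    [J]. *)
Lemma mixture_test (f : {ffun 'I_s -> 'I_m} -> {ffun 'I_s -> bool} -> R) :
  (forall J b, 0 <= f J b <= 1) ->
  (mean (fun J => mean (fun b => mixture J b * f J b)) - mean (fun J => mean (f J))) ^+ 2
  <= mean (fun J => mean (fun b => mixture J b ^+ 2)) - 1.
Proof.
move=> f01.
have J0 : (0 < #|{ffun 'I_s -> 'I_m}|)%N by rewrite card_ffun_gt0 ?card_ord.
have mix1 J : mean (mixture J) = 1.
  rewrite exchange_mean -[RHS](mean_cst 1 (ffun_bool_gt0 m)).
  by apply: eq_mean => z; rewrite mean_tilt.
have -> : mean (fun J => mean (fun b => mixture J b ^+ 2)) - 1 =
    mean (fun J => mean (fun b => (mixture J b - 1) ^+ 2)).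
  rewrite -[X in _ - X](mean_cst 1 J0) -meanB; apply: eq_mean => J.
  rewrite (@eq_mean _ _ (fun b => (mixture J b - 1) ^+ 2)
    (fun b => mixture J b ^+ 2 + (1 - 2 * mixture J b))); last by move=> b; ring.
  by rewrite meanD meanB meanZ mix1 mean_cst ?ffun_bool_gt0//; ring.
rewrite -meanB; apply: le_trans (sqr_mean_le1 _ J0) _; apply: ler_mean => J.
rewrite -meanB; apply: le_trans (sqr_mean_le1 _ (ffun_bool_gt0 s)) _; apply: ler_mean => b.
have /andP[f0 f1] := f01 J b; rewrite -[X in mixture J b * f J b - X]mul1r -mulrBl exprMn.
by rewrite ler_piMr ?sqr_ge0// exprn_ile1.
Qed.

End ChiSquare.

(** * Perturbed distributions on paired points *)

Section Paninski.
Variables (R : realType) (n m : nat) (e : 'I_m * bool -> 'I_n).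
Hypothesis m_gt0 : (0 < m)%N.
Hypothesis e_inj : injective e.

(** Law of the image under [e] of a uniform pair and a biased bit; points outside the image of [e]
    get mass 0. *)
Definition paninski_pmf (t : R) (z : {ffun 'I_m -> bool}) (x : 'I_n) : R :=
  mean (fun j => mean (fun b => (1 + t * sgn R (z j) * sgn R b) * (e (j, b) == x)%:R)).

Lemma paninski_ge0 t z x : 0 <= t <= 1 -> 0 <= [ffun x => paninski_pmf t z x] x.
Proof.
move=> t01; rewrite ffunE; apply: mean_ge0 => j; apply: mean_ge0 => b.
rewrite mulr_ge0//; have : `|t * sgn R (z j) * sgn R b| <= 1.
  by rewrite normrM normr_sgn mulr1 normr_tsgn//; case/andP: t01.
by rewrite ler_norml; lra.
Qed.

Lemma paninski_sum1 t z : \sum_x [ffun x => paninski_pmf t z x] x = 1.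
Proof.
under eq_bigr do rewrite ffunE.
rewrite /paninski_pmf -mean_sum -[RHS](@mean_cst _ 'I_m) ?card_ord//.
apply: eq_mean => j; rewrite -mean_sum.
rewrite (@eq_mean _ _ _ (fun b => 1 + t * sgn R (z j) * sgn R b)).
  by rewrite mean_bool /sgn; field.
move=> b; rewrite -mulr_sumr (bigD1 (e (j, b)))//= eqxx big1 ?addr0 ?mulr1// => x.
by rewrite eq_sym => /negPf ->.
Qed.

Definition paninski t z (t01 : 0 <= t <= 1) : fdist R 'I_n :=
  FDist (fun x => paninski_ge0 z x t01) (paninski_sum1 t z).

Lemma paninskiE t z (t01 : 0 <= t <= 1) j b :
  paninski z t01 (e (j, b)) = (1 + t * sgn R (z j) * sgn R b) / (2 * m%:R).
Proof.
rewrite /= ffunE /paninski_pmf /mean card_ord card_bool (bigD1 j)//= [X in _ + X]big1.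
  rewrite addr0 (bigD1 b)//= eqxx big1 ?addr0 ?mulr1; first by rewrite invfM; ring.
  by move=> b' /negPf bb; rewrite (inj_eq e_inj) xpair_eqE bb andbF mulr0.
move=> j' /negPf jj; rewrite big1 ?mulr0// => b' _.
by rewrite (inj_eq e_inj) xpair_eqE jj mulr0.
Qed.

(** Each of the [2 m] points in the image of [e] contributes [t / (2 m)] to the L1 distance; the
    other points are bounded below by 0. *)
Lemma dTV_paninski t z z' (t01 : 0 <= t <= 1) (z01 : 0 <= (0 : R) <= 1) :
  t / 2 <= dTV (paninski z t01) (paninski z' z01).
Proof.
have mR : 0 < m%:R :> R by rewrite ltr0n.
rewrite dTV_half_l1 mulrC ler_wpM2l ?invr_ge0//.
rewrite (bigID (mem (e @: [set: 'I_m * bool]))) /= big_imset /=; last first.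
  by move=> y y' _ _; exact: e_inj.
rewrite -[leLHS]addr0 lerD//; last by rewrite sumr_ge0.
rewrite (eq_bigr (fun=> t / (2 * m%:R))); last first.
  move=> [j b] _; rewrite (paninskiE z t01) (paninskiE z' z01) mul0r mul0r addr0 -mulrBl addrAC subrr add0r.
  rewrite normrM normrM normr_sgn mulr1 normr_tsgn// ger0_norm// invr_ge0.
  by rewrite mulr_ge0// ltW.
rewrite sumr_const cardsT card_prod card_ord card_bool.
rewrite -[_ *+ _]mulr_natl natrM.
rewrite le_eqVlt; apply/orP; left; apply/eqP; field.
by rewrite gt_eqF.
Qed.

Section Output.
Variable s : nat.

Definition sample (J : {ffun 'I_s -> 'I_m}) (b : {ffun 'I_s -> bool}) : dataset n s :=
  [ffun i => e (J i, b i)].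

(** The product of the means for the single samples is a mean over all pairs and bits, where the
    indicators select the dataset [sample J b]. *)
Lemma output_prob_paninski (A : algorithm R n s) v t z (t01 : 0 <= t <= 1) :
  output_prob A (paninski z t01) v =
  mean (fun J : {ffun 'I_s -> 'I_m} => mean (fun b : {ffun 'I_s -> bool} =>
    tilt (fun i => t * sgn R (z (J i))) b * A (sample J b) v)).
Proof.
pose w (J : {ffun 'I_s -> 'I_m}) (b : {ffun 'I_s -> bool}) :=
  tilt (fun i => t * sgn R (z (J i))) b.
transitivity (\sum_(X : dataset n s)
   mean (fun J => mean (fun b => w J b * (sample J b == X)%:R * A X v))).
  apply: eq_bigr => X _.
  under eq_bigr do rewrite /= ffunE.
  rewrite /paninski_pmf -(mean_prod (fun i j => mean (fun b =>
     (1 + t * sgn R (z j) * sgn R b) * (e (j, b) == X i)%:R))) -meanZr.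
  apply: eq_mean => J; rewrite -(mean_prod (fun i b =>
     (1 + t * sgn R (z (J i)) * sgn R b) * (e (J i, b) == X i)%:R)) -meanZr.
  apply: eq_mean => b; congr (_ * _); rewrite big_split /=; congr (_ * _).
  have [<-|] := eqVneq (sample J b) X.
    by rewrite big1// => i _; rewrite ffunE eqxx.
  case: (boolP [forall i, sample J b i == X i]) => [/forallP h /eqP[]|].
    by apply/ffunP => i; apply/eqP.
  rewrite negb_forall => /existsP[i]; rewrite ffunE => /negPf h _.
  by rewrite (bigD1 i)//= h mul0r.
rewrite -mean_sum; apply: eq_mean => J; rewrite -mean_sum; apply: eq_mean => b.
rewrite (bigD1 (sample J b))//= eqxx mulr1 big1 ?addr0// => X.
by rewrite eq_sym => /negPf ->; rewrite mulr0 mul0r.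
Qed.

(** By injectivity of [e] the two points of a pair differ, so exactly sample [k] changes. *)
Lemma Ham_flip J b k : Ham (sample J b) (sample J (flip k b)) = 1%N.
Proof.
rewrite /Ham -[RHS](cards1 k); apply: eq_card => i; rewrite !inE !ffunE.
rewrite (inj_eq e_inj) xpair_eqE eqxx /=.
by case: (b i); case: (i == k).
Qed.

End Output.
End Paninski.

(** * Privacy as a Lipschitz condition *)

Lemma fdist_le1 (R : numDomainType) (T : finType) (p : fdist R T) x : p x <= 1.
Proof.
rewrite -(fdist_sum1 p) (bigD1 x)//= lerDl sumr_ge0// => y _; exact: fdist_ge0.
Qed.

(** For [xi <= 1/2], [expR xi <= (1 - xi)^-1 <= 1 + 2 xi]. Otherwise [2 xi] exceeds 1, hence any
    difference of probabilities. *)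
Lemma differentially_private_lipschitz (R : realType) (n s : nat) (xi : R)
    (A : algorithm R n s) v (X X' : dataset n s) :
  0 < xi -> differentially_private xi A -> Ham X X' = 1%N ->
  A X v - A X' v <= 2 * xi.
Proof.
move=> xi0 dp XX'; have := dp X X' XX' [set v]; rewrite /Pr !big_set1 => h.
have [a0 a1] := (fdist_ge0 (A X') v, fdist_le1 (A X') v).
have b1 := fdist_le1 (A X) v.
have [xil|xig] := lerP xi (1 / 2); last by lra.
have := expR_ge1Dx (- xi); rewrite expRN => h1.
have e0 := expR_gt0 xi.
have h2 : (1 - xi) * expR xi <= 1.
  by rewrite -[leRHS](mulVf (lt0r_neq0 e0)) ler_wpM2r// ltW.
have h3 : expR xi <= 1 + 2 * xi by nra.
by nra.
Qed.

Lemma Ham_sym n s (X X' : dataset n s) : Ham X X' = Ham X' X.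
Proof. by apply: eq_card => i; rewrite !inE eq_sym. Qed.

(** * Inequalities on [s] forced by the acceptance gap *)

Section Assembly.
Variable R : realType.

Lemma output_prob_sum1 (n m s : nat) (e : 'I_m * bool -> 'I_n) (m_gt0 : (0 < m)%N)
    (A : algorithm R n s) t z (t01 : 0 <= t <= 1) :
  let P := output_prob A (paninski e m_gt0 z t01) in P Accept + P Reject + P Abstain = 1.
Proof.
move=> P; have -> : P Accept + P Reject + P Abstain = \sum_v P v.
  rewrite (bigD1 Accept)//= (bigD1 Reject)/=; last by apply/eqP.
  rewrite (bigD1 Abstain)/=; last by apply/andP; split; apply/eqP.
  by rewrite big_pred0 ?addr0 ?addrA//; case; rewrite eqxx ?andbF.
rewrite /P; under eq_bigr do rewrite output_prob_paninski.
rewrite -mean_sum -[RHS](@mean_cst _ {ffun 'I_s -> 'I_m}) ?card_ffun_gt0 ?card_ord//.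
apply: eq_mean => J; rewrite -mean_sum -[RHS](mean_tilt (fun i => t * sgn R (z (J i)))).
by apply: eq_mean => b; rewrite -mulr_sumr fdist_sum1 mulr1.
Qed.

(** [earlier] is a count, hence 0 or at least 1. *)
Lemma sqrt_earlier_le (m s : nat) (J : {ffun 'I_s -> 'I_m}) (l : 'I_s) :
  Num.sqrt (earlier R J l) <= earlier R J l.
Proof.
rewrite /earlier -natr_sum; case: (\sum_(i < s) _)%N => [|r]; first by rewrite sqrtr0.
have r1 : 1 <= r.+1%:R :> R by rewrite ler1n.
by rewrite -(@ler_pXn2r _ 2) ?nnegrE ?sqrtr_ge0// sqr_sqrtr// expr2 ler_peMr.
Qed.

(** AM-GM; linear in [x], it serves as Jensen's inequality for the square root once averaged. *)
Lemma sqrt_le_mean (x y : R) : 0 <= x -> 0 < y -> Num.sqrt x <= (y + x / y) / 2.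
Proof.
move=> x0 y0; rewrite -{2}(sqr_sqrtr x0).
have := sqr_ge0 (Num.sqrt x - y); set u := Num.sqrt x => h.
rewrite -(ler_pM2r y0) mulrAC mulrDl divfK ?gt_eqF//; nra.
Qed.

Variables (n m s : nat) (e : 'I_m * bool -> 'I_n) (A : algorithm R n s) (t xi : R).
Hypothesis m_gt0 : (0 < m)%N.
Hypothesis e_inj : injective e.
Hypothesis t01 : 0 <= t <= 1.
Hypothesis xi_gt0 : 0 < xi.
Hypothesis dp : differentially_private xi A.

Let f J b : R := A (sample e J b) Accept.

Hypothesis gap : 2 / 5 <=
  mean (fun J => mean (f J)) - mean (fun J => mean (fun b => mixture t J b * f J b)).

Let f01 J b : 0 <= f J b <= 1.
Proof. by rewrite fdist_ge0 fdist_le1. Qed.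

Let f_lipschitz J k b : `|f J b - f J (flip k b)| <= 2 * xi.
Proof.
rewrite ler_norml lerNl opprB; apply/andP; split;
  apply: (differentially_private_lipschitz _ xi_gt0 dp).
  by rewrite Ham_sym Ham_flip.
by rewrite Ham_flip.
Qed.

(** Otherwise the chi-square distance is at most [10/9 - 1 = 1/9], less than the squared gap
    [4/25]. *)
Lemma samples_nonprivate : 1 / 10 <= s%:R ^+ 2 * t ^+ 4 / m%:R.
Proof.
have [t0 t1] := andP t01.
have mR : 1 <= m%:R :> R by rewrite ler1n.
set x := s%:R ^+ 2 * _ / _; rewrite leNgt; apply/negP => xl.
(* As [x = m y^2] with [m >= 1], having [y >= 1] would force [x >= 1]. *)
have y1 : s%:R * t ^+ 2 / m%:R < 1 :> R.
  rewrite ltNge; apply/negP => y1.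
  have : x = (s%:R * t ^+ 2 / m%:R) ^+ 2 * m%:R.
    by rewrite /x; field; rewrite gt_eqF// ltr0n.
  by move: y1; set y := _ / _ => y1 xy; nra.
have x1 : x < 1 by lra.
have := mean_sqr_mixture m_gt0 t01 y1 x1; rewrite -/x => h1.
have := mixture_test t m_gt0 f01; set d := _ - _; set M := mean _ => h2.
have h3 : (1 - x)^-1 <= 10 / 9.
  have -> : 10 / 9 = (9 / 10)^-1 :> R by field.
  by rewrite lef_pV2 ?posrE; lra.
move: gap; rewrite -opprB -/d => hd.
by move: h1; rewrite -/M; nra.
Qed.

(** For fixed [J] the hybrids run from [mean (f J)] to the acceptance under the mixture; the gap is
    the average over [J] of the difference. *)
Lemma gap_le_hybrid (B : {ffun 'I_s -> 'I_m} -> 'I_s -> R) :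
  (forall J (l : 'I_s),
    `|mean (fun z => hybrid_mean J t (f J) l.+1 z - hybrid_mean J t (f J) l z)| <= B J l) ->
  2 / 5 <= \sum_l mean (B^~ l).
Proof.
move=> hB; apply: le_trans gap _.
rewrite -mean_sum -meanB; apply: ler_mean => J.
apply: le_trans (hybrid_telescope (hB J)).
rewrite -normrN opprB; apply: le_trans (ler_norm _).
rewrite lerD2l lerN2 le_eqVlt; apply/orP; left; apply/eqP.
rewrite exchange_mean; apply: eq_mean => b; rewrite -meanZr; apply: eq_mean => z.
by congr (_ * _); apply: eq_bigr => i _; rewrite /hybrid ltn_ord.
Qed.

Lemma samples_private_linear : 2 / 5 <= s%:R * t * xi.
Proof.
apply: le_trans (gap_le_hybrid (B := fun _ _ => t * (2 * xi) / 2) _) _.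
  by move=> J l; apply: hybrid_step_linear => // k b; exact: f_lipschitz.
rewrite (eq_bigr (fun=> t * xi)).
  by rewrite sumr_const card_ord -[_ *+ _]mulr_natl mulrA.
by move=> l _; rewrite mean_cst ?card_ffun_gt0 ?card_ord//; field.
Qed.

Lemma gap_le_earlier :
  2 / 5 <= 3 * t ^+ 2 * xi *
    \sum_l mean (fun J : {ffun 'I_s -> 'I_m} => Num.sqrt (earlier R J l)).
Proof.
apply: le_trans (gap_le_hybrid (B := fun J l =>
  3 / 2 * t ^+ 2 * (2 * xi) * Num.sqrt (earlier R J l)) _) _.
  by move=> J l; apply: hybrid_step_sqrt => // k b; exact: f_lipschitz.
rewrite mulr_sumr; apply: ler_sum => l _; rewrite meanZ.
by rewrite le_eqVlt; apply/orP; left; apply/eqP; field.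
Qed.

Lemma samples_private_quadratic : 2 / 5 <= 3 * t ^+ 2 * xi * (s%:R ^+ 2 / m%:R).
Proof.
have [t0 _] := andP t01; apply: le_trans gap_le_earlier _.
rewrite ler_wpM2l ?mulr_ge0 ?sqr_ge0 ?(ltW xi_gt0)//.
have -> : s%:R ^+ 2 / m%:R = \sum_(l < s) (s%:R / m%:R) :> R.
  by rewrite sumr_const card_ord -[RHS]mulr_natl mulrA expr2.
apply: ler_sum => l _; apply: le_trans (mean_earlier R l m_gt0).
by apply: ler_mean => J; exact: sqrt_earlier_le.
Qed.

Lemma samples_private_sqrt :
  2 / 5 <= 3 * t ^+ 2 * xi * (s%:R * Num.sqrt (s%:R / m%:R)).
Proof.
have mR : 0 < m%:R :> R by rewrite ltr0n.
(* Division by [y] below needs [s > 0], which the linear bound forces. *)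
have sR : 0 < s%:R :> R.
  rewrite ltr0n lt0n; apply/negP => /eqP s0.
  by have := samples_private_linear; rewrite s0 !mul0r; lra.
set y := Num.sqrt _; have y0 : 0 < y by rewrite sqrtr_gt0 divr_gt0.
have [t0 _] := andP t01; apply: le_trans gap_le_earlier _.
rewrite ler_wpM2l ?mulr_ge0 ?sqr_ge0 ?(ltW xi_gt0)//.
have -> : s%:R * y = \sum_(l < s) y :> R by rewrite sumr_const card_ord -[RHS]mulr_natl.
apply: ler_sum => l _.
apply: (@le_trans _ _ (mean (fun J : {ffun 'I_s -> 'I_m} => (y + earlier R J l / y) / 2))).
  by apply: ler_mean => J; rewrite sqrt_le_mean ?earlier_ge0.
rewrite meanZr meanD meanZr mean_cst ?card_ffun_gt0 ?card_ord//.
have := mean_earlier R l m_gt0; set E := mean _ => hE.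
have : E / y <= y.
  by rewrite ler_pdivrMr// -expr2 sqr_sqrtr ?divr_ge0.
by lra.
Qed.

End Assembly.

(** Roots are cleared by squaring or cubing. The four terms, in order, are at most 100, 40, 20 and
    10 times [s], in total 170 times, which [1/200] absorbs. *)
Lemma sample_bound_le (R : realType) (n m s : nat) (eps xi t : R) :
  (n <= 3 * m)%N -> (0 < m)%N -> 0 < eps -> 0 < xi -> 0 < t <= 4 * eps ->
  1 / 10 <= s%:R ^+ 2 * t ^+ 4 / m%:R ->
  2 / 5 <= s%:R * t * xi ->
  2 / 5 <= 3 * t ^+ 2 * xi * (s%:R ^+ 2 / m%:R) ->
  2 / 5 <= 3 * t ^+ 2 * xi * (s%:R * Num.sqrt (s%:R / m%:R)) ->
  ((1 / 200)%:E * sample_bound n eps xi <= s%:R%:E)%E.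
Proof.
move=> n3m m0 eps0 xi0 /andP[t0 t4] h1 h2 h3 h4.
have nm : n%:R <= 3 * m%:R :> R by rewrite -natrM ler_nat.
have mR : 0 < m%:R :> R by rewrite ltr0n.
have S0 : 0 <= s%:R :> R by [].
have n0 : 0 <= n%:R :> R by [].
rewrite sample_bound_gt0// -EFinM lee_fin.
move: h1 h2 h3 h4 nm S0 n0 mR; set S := s%:R; set M := m%:R; set N := n%:R.
move=> h1 h2 h3 h4 nm S0 n0 mR.
have [M0 e0 x0 t0'] := And4 (ltW mR) (ltW eps0) (ltW xi0) (ltW t0).
have tX k : t ^+ k <= (4 * eps) ^+ k by apply: lerXn2r; rewrite ?nnegrE ?mulr_ge0.
have b1 : Num.sqrt N / eps ^+ 2 <= 100 * S.
  rewrite -(@ler_pXn2r _ 2) ?nnegrE ?divr_ge0 ?sqrtr_ge0 ?exprn_ge0 ?mulr_ge0//.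
  rewrite expr_div_n sqr_sqrtr// -exprM ler_pdivrMr ?exprn_gt0//.
  move: h1; rewrite ler_pdivlMr// => h1; have := tX 4%N; rewrite exprMn => t44.
  have : S ^+ 2 * t ^+ 4 <= S ^+ 2 * (4 ^+ 4 * eps ^+ 4) by rewrite ler_wpM2l ?sqr_ge0.
  have : 0 <= S ^+ 2 * eps ^+ 4 by rewrite mulr_ge0 ?exprn_ge0.
  by rewrite exprMn; lra.
have b2 : 1 / (eps * xi) <= 10 * S.
  rewrite ler_pdivrMr ?mulr_gt0//.
  have : S * t * xi <= S * (4 * eps) * xi by rewrite ler_wpM2r ?ler_wpM2l.
  by lra.
have b3 : Num.sqrt N / (eps * Num.sqrt xi) <= 20 * S.
  have sx : 0 < Num.sqrt xi by rewrite sqrtr_gt0.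
  rewrite -(@ler_pXn2r _ 2) ?nnegrE ?divr_ge0 ?mulr_ge0 ?sqrtr_ge0//.
  rewrite expr_div_n exprMn !sqr_sqrtr// ler_pdivrMr ?mulr_gt0 ?exprn_gt0//.
  move: h3; rewrite mulrA ler_pdivlMr// => h3; have := tX 2%N; rewrite exprMn => t22.
  have : xi * S ^+ 2 * t ^+ 2 <= xi * S ^+ 2 * (4 ^+ 2 * eps ^+ 2).
    by rewrite ler_wpM2l ?mulr_ge0 ?sqr_ge0.
  have : 0 <= xi * S ^+ 2 * eps ^+ 2 by rewrite !mulr_ge0 ?exprn_ge0.
  by rewrite exprMn; lra.
have b4 : N `^ 3^-1 / (eps `^ (4 / 3) * xi `^ (2 / 3)) <= 40 * S.
  (* Makes the exponents [k/3] integers, so that the comparison becomes polynomial. *)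
  have cube (x y : R) k : 0 <= x -> y = k%:R / 3 -> (x `^ y) ^+ 3 = x ^+ k.
    move=> x_ge0 ->; rewrite -powR_mulrn ?powR_ge0// -powRrM divfK ?pnatr_eq0//.
    by rewrite powR_mulrn.
  rewrite -(@ler_pXn2r _ 3) ?nnegrE ?divr_ge0 ?mulr_ge0 ?powR_ge0//.
  rewrite expr_div_n exprMn (cube N _ 1%N) ?div1r// (cube eps _ 4%N)// (cube xi _ 2%N)//.
  rewrite expr1 ler_pdivrMr ?mulr_gt0 ?exprn_gt0//.
  have h5 : 4 / 25 <= (3 * t ^+ 2 * xi * (S * Num.sqrt (S / M))) ^+ 2.
    have p0 : 0 <= 2 / 5 :> R by lra.
    have -> : 4 / 25 = 2 / 5 * (2 / 5) :> R by field.
    by rewrite expr2 ler_pM.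
  move: h5; rewrite [leRHS](_ : _ = 9 * (xi ^+ 2 * S ^+ 2 * t ^+ 4) * Num.sqrt (S / M) ^+ 2);
    last by ring.
  rewrite sqr_sqrtr ?divr_ge0// mulrA ler_pdivlMr// => h5.
  have := tX 4%N; rewrite exprMn => t44.
  have : xi ^+ 2 * S ^+ 3 * t ^+ 4 <= xi ^+ 2 * S ^+ 3 * (4 ^+ 4 * eps ^+ 4).
    by rewrite ler_wpM2l ?mulr_ge0 ?exprn_ge0.
  have : 0 <= xi ^+ 2 * S ^+ 3 * eps ^+ 4 by rewrite !mulr_ge0 ?exprn_ge0.
  by move: h5; lra.
by lra.
Qed.

(** * Pairing up the points of ['I_n] *)

Section Pairing.
Variable n : nat.

Lemma pairing_subproof (y : 'I_n./2 * bool) : (y.2 + y.1.*2 < n)%N.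
Proof.
case: y => j b /=; rewrite -[X in (_ < X)%N]odd_double_half.
apply: leq_trans (leq_addl _ _); apply: (@leq_trans j.+1.*2); last by rewrite leq_double.
by rewrite doubleS ltnS; case: b.
Qed.

(** For odd [n] the last point stays unpaired. *)
Definition pairing (y : 'I_n./2 * bool) : 'I_n := Ordinal (pairing_subproof y).

(** Halving recovers the pair, parity the bit. *)
Lemma pairing_inj : injective pairing.
Proof.
move=> [j b] [j' b'] /(congr1 val) /= h; congr (_, _).
  by apply: val_inj; rewrite /= -(half_bit_double j b) h half_bit_double.
by have := congr1 odd h; rewrite !oddD !odd_double !addbF !oddb.
Qed.

End Pairing.

(** The bound is worst case over the reference, which is fixed before the prediction and the
    parameters. For [n = 1] there is a single distribution, and always accepting takes no
    samples. *)
Theorem theorem9 (R : realType) :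
  exists2 c : R, 0 < c &
  forall n : nat, (1 < n)%N ->
  exists q : fdist R 'I_n,
  forall (phat : fdist R 'I_n) (eps alpha xi : R),
    0 <= eps < 1 / 2 -> 0 <= alpha < 1 / 2 -> 0 < xi ->
    dTV q phat < alpha ->
  forall (s : nat) (A : algorithm R n s),
    private_augmented_tester q phat xi eps alpha (1 / 5) A ->
    (c%:E * sample_bound n eps xi <= s%:R%:E)%E.
Proof.
exists (1 / 200); first by lra.
move=> n n1; have m0 : (0 < n./2)%N by rewrite half_gt0.
have z01 : 0 <= (0 : R) <= 1 by rewrite lexx ler01.
pose z0 : {ffun 'I_n./2 -> bool} := [ffun=> false].
pose e := @pairing n; have e_inj : injective e := @pairing_inj n.
exists (paninski e m0 z0 z01) => phat eps alpha xi /andP[eps0 eps2] _ xi0 near s A.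
case=> dp rej acc abst.
have gap (t : R) : 2 * eps < t <= 1 -> 2 / 5 <=
    mean (fun J => mean (fun b => A (sample e J b) Accept))
    - mean (fun J => mean (fun b => mixture t J b * A (sample e J b) Accept)).
  move=> /andP[t2 t1]; have t01 : 0 <= t <= 1 by rewrite t1 andbT; lra.
  (* Under [p = q] rejection has probability at most 1/5, and so has abstention because [phat] is
     within [alpha] of [q]. *)
  have hq : 3 / 5 <= mean (fun J => mean (fun b => A (sample e J b) Accept)).
    have := output_prob_sum1 e m0 A z0 z01; move: rej (abst _ (ltW near)).
    rewrite /= [output_prob _ _ Accept]output_prob_paninski => h1 h2.
    rewrite (@eq_mean _ _ _ (fun J => mean (fun b => A (sample e J b) Accept))); first by lra.
    move=> J; apply: eq_mean => b; rewrite /tilt big1 ?mul1r// => i _.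
    by rewrite !mul0r addr0.
  suff : mean (fun J => mean (fun b => mixture t J b * A (sample e J b) Accept)) <= 1 / 5.
    by lra.
  (* Acceptance under the mixture is the average over [z] of that under the perturbed laws, each at
     most 1/5. *)
  rewrite (@eq_mean _ _ _ (fun J : {ffun 'I_s -> 'I_n./2} => mean (fun z : {ffun 'I_n./2 -> bool} =>
    mean (fun b : {ffun 'I_s -> bool} =>
      tilt (fun i => t * sgn R (z (J i))) b * A (sample e J b) Accept)))); last first.
    by move=> J; rewrite exchange_mean; apply: eq_mean => b; rewrite meanZr.
  rewrite exchange_mean -[leRHS](mean_cst _ (ffun_bool_gt0 n./2)); apply: ler_mean => z.
  rewrite -(output_prob_paninski e m0 A Accept z t01); apply: acc.
  have := dTV_paninski m0 e_inj z z0 t01 z01; have : eps < t / 2 by lra.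
  exact: lt_le_trans.
move: eps0; rewrite le_eqVlt => /predU1P[e0|eps0]; last first.
  (* The cap at 1 keeps the tilts nonnegative; since [eps < 1/2], [t] still exceeds [2 * eps]. *)
  pose t := Num.min (4 * eps) 1.
  have tlt : 2 * eps < t <= 1 by rewrite /t lt_min ge_min lexx orbT andbT; apply/andP; split; lra.
  have t4 : t <= 4 * eps by rewrite ge_min lexx.
  have [t2 t1] := andP tlt.
  have t01 : 0 <= t <= 1 by rewrite t1 andbT; lra.
  apply: (sample_bound_le (m := n./2) (t := t)) => //.
  (* With [m = n./2 >= 1], [n <= 2 m + 1 <= 3 m]. *)
  - rewrite -{1}(odd_double_half n) mulSn -muln2 mulnC leq_add//.
    by apply: (leq_trans _ m0); case: odd.
  - by rewrite t4 andbT; lra.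
  - exact: samples_nonprivate (gap _ tlt).
  - exact: samples_private_linear (gap _ tlt).
  - exact: samples_private_quadratic (gap _ tlt).
  - exact: samples_private_sqrt (gap _ tlt).
(* For [eps = 0] the bound is infinite: no tester exists, because [t] may be
   chosen small in terms of [s]. *)
pose t : R := (10 * (s%:R + 1))^-1.
have s1 : 0 < 10 * (s%:R + 1) :> R by rewrite mulr_gt0// ltr_wpDl.
have t0 : 0 < t by rewrite invr_gt0.
have ts : t * (s%:R + 1) = 1 / 10 by rewrite /t; field; rewrite gt_eqF// ltr_wpDl.
have sR : 0 <= s%:R :> R by [].
have t1 : t <= 1 by nra.
have tlt : 2 * eps < t <= 1 by rewrite -e0 mulr0 t0.
have t01 : 0 <= t <= 1 by rewrite t1 ltW.
(* This alone is contradictory: it forces [m / 10 <= s^2 t^4], whereas [s t <= 1/10] and [t <= 1]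
   give at most [1/100]. *)
have := samples_nonprivate m0 t01 (gap _ tlt).
have mR : 1 <= (n./2)%:R :> R by rewrite ler1n.
rewrite ler_pdivlMr ?ltr0n// => h.
have ts1 : s%:R * t <= 1 / 10 by nra.
have : s%:R ^+ 2 * t ^+ 4 <= 1 / 100.
  have -> : s%:R ^+ 2 * t ^+ 4 = (s%:R * t * t) ^+ 2 by ring.
  have u0 : 0 <= s%:R * t * t by rewrite !mulr_ge0// ltW.
  have u1 : s%:R * t * t <= 1 / 10 by nra.
  by nra.
by move=> h'; exfalso; lra.
Qed.
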